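(* Let $M$ be a maximal translation surface in $\mathbb{L}^3$, $X(s,t)=\alpha(s)+\beta(t)$, whose generating curves $\alpha,\beta$ are of Frenet type. If both curves are non-planar, then $$\kappa_\alpha^2\tau_\alpha=c_1\neq0,\qquad \kappa_\beta^2\tau_\beta=\bar c_1\neq0,\qquad \frac{\Sigma_\alpha}{\tau_\alpha}+\tau_\alpha=c_2,\qquad \frac{\Sigma_\beta}{\tau_\beta}+\tau_\beta=\bar c_2,$$ where $c_1,c_2,\bar c_1,\bar c_2$ are constants.
   Context: $\mathbb{L}^3$ is $\mathbb{R}^3$ with the metric $\langle\cdot,\cdot\rangle=dx^2+dy^2-dz^2$. A vector $v$ is spacelike if $\langle v,v\rangle>0$ or $v=0$, timelike if $\langle v,v\rangle<0$. The vector product is defined by $\langle u\times v,w\rangle=\det(u,v,w)$. A translation surface is parametrized by $X(s,t)=\alpha(s)+\beta(t)$ with $\alpha,\beta$ smooth curves (the generating curves) on real intervals and $\alpha'(s),\beta'(t)$ linearly independent for all $s,t$. It is maximal if its induced metric is Riemannian and its mean curvature vanishes; for generating curves parametrized by arc length the latter reads $\det(\alpha',\beta',\alpha'')+\det(\alpha',\beta',\beta'')=0$. All generating curves are spacelike and parametrized by arc length. Such a curve $\alpha$ is of Frenet type if $\alpha''$ is everywhere nonzero spacelike or everywhere timelike. Then $\mathbf t=\alpha'$, $\kappa=|\mathbf t'|=\sqrt{|\langle \mathbf t',\mathbf t'\rangle|}>0$, $\mathbf n=\mathbf t'/\kappa$, $\mathbf b=\mathbf t\times\mathbf n$, $\epsilon=\langle\mathbf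 n,\mathbf n\rangle\in\{-1,1\}$, and the torsion $\tau$ is defined by the Frenet equations $\mathbf t'=\kappa\mathbf n$, $\mathbf n'=-\epsilon\kappa\mathbf t+\tau\mathbf b$, $\mathbf b'=\tau\mathbf n$. For a non-planar such curve put $$\Sigma=\left(\frac{\kappa'}{\kappa}\right)'+\epsilon\kappa^2+\tau^2 .$$ Subscripts $\alpha,\beta$ indicate the curve. Planar means contained in an affine plane. *)

(* Defs.v *)
From Stdlib Require Import Reals Lra Psatz.
From Coquelicot Require Import Coquelicot.
Open Scope R_scope.

(** Coquelicot's product structure supplies [plus], [scal] and [zero]. *)
Definition vec : Type := (R * R * R)%type.

Definition vx (v : vec) : R := fst (fst v).
Definition vy (v : vec) : R := snd (fst v).
Definition vz (v : vec) : R := snd v.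

Definition inner (u v : vec) : R := vx u * vx v + vy u * vy v - vz u * vz v.

Definition lnorm (v : vec) : R := sqrt (Rabs (inner v v)).

Definition spacelike (v : vec) : Prop := inner v v > 0 \/ v = zero.
Definition timelike (v : vec) : Prop := inner v v < 0.

Definition det3 (u v w : vec) : R :=
  vx u * (vy v * vz w - vz v * vy w)
  - vy u * (vx v * vz w - vz v * vx w)
  + vz u * (vx v * vy w - vy v * vx w).

(** The sign of the last coordinate differs from the Euclidean cross product;
    the formula is the one forced by [inner (cross u v) w = det3 u v w]. *)
Definition cross (u v : vec) : vec :=
  (vy u * vz v - vz u * vy v,
   vz u * vx v - vx u * vz v,
   - (vx u * vy v - vy u * vx v)).

Definition lin_indep (u v : vec) : Prop :=
  forall a b : R, plus (scal a u) (scal b v) = zero -> a = 0 /\ b = 0.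

(** A curve on an interval [I] is represented by a total function [R -> vec],
    smooth in a neighbourhood of every point of [I].  If [I] is open this is
    ordinary smoothness on [I]; if an endpoint belongs to [I] the values
    beyond it form a smooth extension, and the derivatives at the endpoint,
    being limits from inside, do not depend on its choice. *)

Definition is_interval (I : R -> Prop) : Prop :=
  (forall x y z, I x -> I z -> x <= y <= z -> I y) /\
  (exists x y, I x /\ I y /\ x < y).

Definition curve : Type := R -> vec.

Definition smooth_on (I : R -> Prop) (a : curve) : Prop :=
  forall s, I s -> locally s (fun u => forall n : nat,
    ex_derive_n (fun w => vx (a w)) n u /\
    ex_derive_n (fun w => vy (a w)) n u /\
    ex_derive_n (fun w => vz (a w)) n u).

Definition vderive (a : curve) : curve := fun s =>
  (Derive (fun u => vx (a u)) s,
   Derive (fun u => vy (a u)) s,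
   Derive (fun u => vz (a u)) s).

Definition spacelike_curve (I : R -> Prop) (a : curve) : Prop :=
  forall s, I s -> spacelike (vderive a s).

Definition arc_length (I : R -> Prop) (a : curve) : Prop :=
  forall s, I s -> lnorm (vderive a s) = 1.

Definition affine_plane (P : vec -> Prop) : Prop :=
  exists a b c d : R, (a, b, c) <> (0, 0, 0) /\
    forall p, P p <-> a * vx p + b * vy p + c * vz p = d.

Definition planar (I : R -> Prop) (a : curve) : Prop :=
  exists P, affine_plane P /\ forall s, I s -> P (a s).

Definition frenet_type (I : R -> Prop) (a : curve) : Prop :=
  (forall s, I s -> vderive (vderive a) s <> zero /\
                    spacelike (vderive (vderive a) s)) \/
  (forall s, I s -> timelike (vderive (vderive a) s)).

Definition tangent (a : curve) : curve := vderive a.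

Definition curvature (a : curve) (s : R) : R := lnorm (vderive (tangent a) s).

Definition normal (a : curve) : curve := fun s =>
  scal (/ curvature a s) (vderive (tangent a) s).

Definition binormal (a : curve) : curve := fun s =>
  cross (tangent a s) (normal a s).

Definition normal_sign (a : curve) (s : R) : R := inner (normal a s) (normal a s).

(** The torsion is specified as the coefficient making the Frenet equations
    hold on [I]; see [torsion_exists]. *)
Definition is_torsion (I : R -> Prop) (a : curve) (tau : R -> R) : Prop :=
  forall s, I s ->
    vderive (tangent a) s = scal (curvature a s) (normal a s) /\
    vderive (normal a) s =
      plus (scal (- normal_sign a s * curvature a s) (tangent a s))
           (scal (tau s) (binormal a s)) /\
    vderive (binormal a) s = scal (tau s) (normal a s).

Definition Sigma (a : curve) (tau : R -> R) (s : R) : R :=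
  Derive (fun u => Derive (curvature a) u / curvature a u) s
  + normal_sign a s * curvature a s ^ 2 + tau s ^ 2.

Definition surface : Type := R -> R -> vec.

Definition d1 (X : surface) : surface := fun s t => vderive (fun u => X u t) s.
Definition d2 (X : surface) : surface := fun s t => vderive (fun u => X s u) t.

Definition riemannian_on (I J : R -> Prop) (X : surface) : Prop :=
  forall s t, I s -> J t -> forall a b : R, (a, b) <> (0, 0) ->
    let w := plus (scal a (d1 X s t)) (scal b (d2 X s t)) in
    inner w w > 0.

Definition unit_normal (X : surface) : surface := fun s t =>
  let N := cross (d1 X s t) (d2 X s t) in scal (/ lnorm N) N.

(** Half the trace of the second fundamental form with respect to the first.
    The factor [inner n n], which is [-1] on a spacelike surface, is the usual
    Lorentzian sign convention. *)
Definition mean_curvature (X : surface) (s t : R) : R :=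
  let n := unit_normal X s t in
  let E := inner (d1 X s t) (d1 X s t) in
  let F := inner (d1 X s t) (d2 X s t) in
  let G := inner (d2 X s t) (d2 X s t) in
  let e := inner n (d1 (d1 X) s t) in
  let f := inner n (d2 (d1 X) s t) in
  let g := inner n (d2 (d2 X) s t) in
  inner n n * (e * G - 2 * f * F + g * E) / (2 * (E * G - F ^ 2)).

Definition maximal_on (I J : R -> Prop) (X : surface) : Prop :=
  riemannian_on I J X /\
  forall s t, I s -> J t -> mean_curvature X s t = 0.

Definition sum_surface (a b : curve) : surface := fun s t => plus (a s) (b t).

Definition translation_surface (I J : R -> Prop) (a b : curve) : Prop :=
  is_interval I /\ is_interval J /\ smooth_on I a /\ smooth_on J b /\
  forall s t, I s -> J t -> lin_indep (vderive a s) (vderive b t).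

Lemma cross_spec (u v w : vec) : inner (cross u v) w = det3 u v w.
Proof. unfold inner, cross, det3, vx, vy, vz; simpl; ring. Qed.

Lemma cross_unique (u v p : vec) :
  (forall w, inner p w = det3 u v w) -> p = cross u v.
Proof.
  intros H.
  assert (H1 := H (1, 0, 0)). assert (H2 := H (0, 1, 0)). assert (H3 := H (0, 0, 1)).
  destruct p as [[p1 p2] p3].
  unfold inner, cross, det3, vx, vy, vz in *; simpl in *.
  repeat f_equal; lra.
Qed.

Lemma vec_ext (u v : vec) : vx u = vx v -> vy u = vy v -> vz u = vz v -> u = v.
Proof.
  destruct u as [[u1 u2] u3], v as [[v1 v2] v3]; unfold vx, vy, vz; simpl.
  intros -> -> ->; reflexivity.
Qed.

Lemma Derive_const_on (I : R -> Prop) (f : R -> R) (c s : R) :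
  is_interval I -> I s -> ex_derive f s -> (forall u, I u -> f u = c) ->
  Derive f s = 0.
Proof.
  intros [Hc [x [y [Ix [Iy Hxy]]]]] Is Hd Hf.
  assert (Hz : exists z, I z /\ z <> s).
  { destruct (Req_dec x s) as [E|E]; [exists y | exists x]; split; auto; lra. }
  destruct Hz as [z [Iz Hz]].
  apply Derive_correct in Hd. apply is_derive_Reals in Hd.
  destruct (Req_dec (Derive f s) 0) as [E|E]; [exact E|exfalso].
  destruct (Hd (Rabs (Derive f s)) (Rabs_pos_lt _ E)) as [[d Hdp] Hdd].
  simpl in Hdd.
  assert (Hh : exists h, h <> 0 /\ Rabs h < d /\ I (s + h)).
  { destruct (Rlt_or_le s z) as [L|L].
    - exists (Rmin (d / 2) (z - s)).
      assert (M1 := Rmin_l (d / 2) (z - s)). assert (M2 := Rmin_r (d / 2) (z - s)).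
      assert (M3 : 0 < Rmin (d / 2) (z - s)) by (apply Rmin_glb_lt; lra).
      repeat split; try lra.
      + rewrite Rabs_pos_eq; lra.
      + apply (Hc s _ z); auto; lra.
    - exists (- Rmin (d / 2) (s - z)).
      assert (M1 := Rmin_l (d / 2) (s - z)). assert (M2 := Rmin_r (d / 2) (s - z)).
      assert (M3 : 0 < Rmin (d / 2) (s - z)) by (apply Rmin_glb_lt; lra).
      repeat split; try lra.
      + rewrite Rabs_Ropp, Rabs_pos_eq; lra.
      + apply (Hc z _ s); auto; lra. }
  destruct Hh as [h [h0 [hd Ih]]].
  specialize (Hdd h h0 hd). rewrite (Hf _ Ih), (Hf _ Is) in Hdd.
  replace ((c - c) / h - Derive f s) with (- Derive f s) in Hdd by (field; auto).
  rewrite Rabs_Ropp in Hdd. lra.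
Qed.

Lemma frame_expansion (t n v : vec) (sg : R) :
  inner t t = 1 -> inner t n = 0 -> inner n n = sg -> sg * sg = 1 ->
  v = plus (plus (scal (inner v t) t) (scal (sg * inner v n) n))
           (scal (- sg * inner v (cross t n)) (cross t n)).
Proof.
  intros Htt Htn Hnn Hs.
  assert (K : forall c : vec -> R, c = vx \/ c = vy \/ c = vz ->
    (inner t n * inner t n - inner t t * inner n n) * c v =
    (inner t n * inner v n - inner n n * inner v t) * c t +
    (inner t n * inner v t - inner t t * inner v n) * c n +
    inner v (cross t n) * c (cross t n)).
  { intros c [-> | [-> | ->]]; unfold inner, cross, vx, vy, vz; simpl; ring. }
  assert (L : forall c : vec -> R, c = vx \/ c = vy \/ c = vz ->
    c v = inner v t * c t + sg * inner v n * c n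
          + - sg * inner v (cross t n) * c (cross t n)).
  { intros c H. generalize (K c H). rewrite Htt, Htn, Hnn. intros Q.
    replace (c v) with (sg * sg * c v) by (rewrite Hs; ring).
    replace (sg * sg * c v) with (- sg * ((0 * 0 - 1 * sg) * c v)) by ring.
    rewrite Q.
    replace (- sg * ((0 * inner v n - sg * inner v t) * c t +
      (0 * inner v t - 1 * inner v n) * c n + inner v (cross t n) * c (cross t n)))
      with (sg * sg * (inner v t * c t) + sg * inner v n * c n
            + - sg * inner v (cross t n) * c (cross t n)) by ring.
    rewrite Hs; ring. }
  apply vec_ext; [apply (L vx)|apply (L vy)|apply (L vz)]; tauto.
Qed.

Definition vdiff (a : curve) (s : R) : Prop :=
  ex_derive (fun u => vx (a u)) s /\
  ex_derive (fun u => vy (a u)) s /\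
  ex_derive (fun u => vz (a u)) s.

Lemma is_derive_cross2 (f g h k : R -> R) (s : R) :
  ex_derive f s -> ex_derive g s -> ex_derive h s -> ex_derive k s ->
  is_derive (fun u => f u * g u - h u * k u) s
    (Derive f s * g s + f s * Derive g s - (Derive h s * k s + h s * Derive k s)).
Proof.
  intros Hf Hg Hh Hk. auto_derive; [repeat split; assumption|].
  change (fun x : R => f x) with f.
  change (fun x : R => g x) with g.
  change (fun x : R => h x) with h.
  change (fun x : R => k x) with k.
  ring.
Qed.

Lemma is_derive_lor (f g h k p q : R -> R) (s : R) :
  ex_derive f s -> ex_derive g s -> ex_derive h s -> ex_derive k s ->
  ex_derive p s -> ex_derive q s ->
  is_derive (fun u => f u * k u + g u * p u - h u * q u) s
    (Derive f s * k s + Derive g s * p s - Derive h s * q s +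
     (f s * Derive k s + g s * Derive p s - h s * Derive q s)).
Proof.
  intros. auto_derive; [repeat split; assumption|].
  change (fun x : R => f x) with f.
  change (fun x : R => g x) with g.
  change (fun x : R => h x) with h.
  change (fun x : R => k x) with k.
  change (fun x : R => p x) with p.
  change (fun x : R => q x) with q.
  ring.
Qed.

Lemma is_derive_inner (a b : curve) (s : R) : vdiff a s -> vdiff b s ->
  is_derive (fun u => inner (a u) (b u)) s
    (inner (vderive a s) (b s) + inner (a s) (vderive b s)).
Proof.
  intros (A1 & A2 & A3) (B1 & B2 & B3).
  unfold inner. apply is_derive_lor; assumption.
Qed.

Lemma vderive_cross (a b : curve) (s : R) : vdiff a s -> vdiff b s ->
  vderive (fun u => cross (a u) (b u)) s =
  plus (cross (vderive a s) (b s)) (cross (a s) (vderive b s)).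
Proof.
  intros (A1 & A2 & A3) (B1 & B2 & B3).
  assert (X := is_derive_unique _ _ _ (is_derive_cross2 _ _ _ _ s A2 B3 A3 B2)).
  assert (Y := is_derive_unique _ _ _ (is_derive_cross2 _ _ _ _ s A3 B1 A1 B3)).
  assert (Z := is_derive_unique _ _ _ (is_derive_cross2 _ _ _ _ s A1 B2 A2 B1)).
  apply vec_ext.
  - refine (eq_trans X _). unfold vderive, cross, vx, vy, vz, plus; simpl; unfold plus; simpl; ring.
  - refine (eq_trans Y _). unfold vderive, cross, vx, vy, vz, plus; simpl; unfold plus; simpl; ring.
  - refine (eq_trans (Derive_opp _ s) _). refine (eq_trans (f_equal Ropp Z) _).
    unfold vderive, cross, vx, vy, vz, plus; simpl; unfold plus; simpl; ring.
Qed.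

(** Hence the hypothesis [is_torsion] is never vacuous on a Frenet type curve. *)
Lemma torsion_exists (I : R -> Prop) (a : curve) :
  is_interval I -> smooth_on I a -> spacelike_curve I a -> arc_length I a ->
  frenet_type I a -> exists tau, is_torsion I a tau.
Proof.
  intros HI Hsm Hsp Hal Hfr.
  set (D := fun s => inner (vderive (tangent a) s) (vderive (tangent a) s)).
  assert (Hsg : exists sg, sg * sg = 1 /\ forall s, I s -> 0 < sg * D s).
  { destruct Hfr as [H|H]; [exists 1 | exists (-1)]; (split; [ring|]);
      intros s Is; specialize (H s Is); unfold D, tangent.
    - destruct H as [N [P|P]]; [lra|contradiction].
    - unfold timelike in H; lra. }
  destruct Hsg as [sg [Hsg HD]].
  assert (Hsg1 : Rabs sg = 1).
  { assert (E : sg = 1 \/ sg = -1) by nra.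
    destruct E as [-> | ->]; [|rewrite Rabs_left by lra]; try rewrite Rabs_R1; lra. }
  assert (Htt : forall s, I s -> inner (tangent a s) (tangent a s) = 1).
  { intros s Is. specialize (Hal s Is). specialize (Hsp s Is).
    unfold tangent, lnorm in *.
    destruct Hsp as [P|P].
    - rewrite Rabs_pos_eq in Hal by lra.
      rewrite <- (sqrt_sqrt (inner (vderive a s) (vderive a s))) by lra.
      rewrite Hal; ring.
    - exfalso. rewrite P in Hal. unfold inner, vx, vy, vz, zero in Hal; simpl in Hal.
      unfold zero in Hal; simpl in Hal.
      replace (0 * 0 + 0 * 0 - 0 * 0) with 0 in Hal by ring.
      rewrite Rabs_R0, sqrt_0 in Hal; lra. }
  assert (Hk : forall s, I s -> 0 < curvature a s /\
                  curvature a s * curvature a s = sg * D s).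
  { intros s Is. specialize (HD s Is). unfold curvature, lnorm. fold (D s).
    assert (E : Rabs (D s) = sg * D s).
    { rewrite <- (Rabs_pos_eq (sg * D s)) by lra. rewrite Rabs_mult, Hsg1; ring. }
    rewrite E. split; [apply sqrt_lt_R0; lra | apply sqrt_sqrt; lra]. }
  assert (dT : forall s, I s -> vdiff (tangent a) s).
  { intros s Is. destruct (locally_singleton _ _ (Hsm s Is) 2%nat) as (A & B & C).
    exact (conj A (conj B C)). }
  assert (dT' : forall s, I s -> vdiff (vderive (tangent a)) s).
  { intros s Is. destruct (locally_singleton _ _ (Hsm s Is) 3%nat) as (A & B & C).
    exact (conj A (conj B C)). }
  assert (dk : forall s, I s -> ex_derive (curvature a) s).
  { intros s Is.
    assert (E : ex_derive D s).
    { eexists. apply is_derive_inner; apply dT'; exact Is. }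
    unfold curvature, lnorm.
    apply (ex_derive_comp sqrt (fun u => Rabs (D u))).
    - exists (/ (2 * sqrt (Rabs (D s)))). apply is_derive_Reals.
      apply derivable_pt_lim_sqrt, Rabs_pos_lt. intros Z. specialize (HD s Is).
      rewrite Z in HD; lra.
    - apply (ex_derive_comp Rabs D); [|exact E].
      eexists. apply is_derive_Rabs; [apply is_derive_id|].
      intros Z. specialize (HD s Is). rewrite Z in HD; lra. }
  assert (dn : forall s, I s -> vdiff (normal a) s).
  { intros s Is. destruct (dT' s Is) as (A & B & C). destruct (Hk s Is) as [Kp _].
    assert (Ki : ex_derive (fun u => / curvature a u) s).
    { apply ex_derive_inv; [apply dk; exact Is | lra]. }
    unfold vdiff, normal.
    repeat split; apply (ex_derive_mult (fun u => / curvature a u)); assumption. }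
  assert (Hnn : forall s, I s -> inner (normal a s) (normal a s) = sg).
  { intros s Is. destruct (Hk s Is) as [Kp Kq].
    assert (E : inner (normal a s) (normal a s)
                = D s / (curvature a s * curvature a s)).
    { unfold D, normal, inner, vx, vy, vz, scal; simpl; unfold scal; simpl;
        unfold mult; simpl. field; lra. }
    assert (Dn := HD s Is).
    assert (D s <> 0) by (intros Z; rewrite Z in Dn; lra).
    assert (sg <> 0) by (intros Z; rewrite Z in Dn; lra).
    rewrite E, Kq.
    replace (D s / (sg * D s)) with (sg / (sg * sg)) by (field; auto).
    rewrite Hsg; field. }
  assert (HT' : forall s, I s ->
            vderive (tangent a) s = scal (curvature a s) (normal a s)).
  { intros s Is. destruct (Hk s Is) as [Kp _].
    apply vec_ext; unfold normal, vx, vy, vz, scal; simpl; unfold scal; simpl;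
        unfold mult; simpl; field; lra. }
  assert (IC : forall k u v, inner (scal k u) v = k * inner u v).
  { intros k u v. unfold inner, vx, vy, vz, scal; simpl; unfold scal; simpl;
        unfold mult; simpl; ring. }
  assert (IS : forall u v, inner u v = inner v u).
  { intros u v; unfold inner; ring. }
  assert (Htn : forall s, I s -> inner (tangent a s) (normal a s) = 0).
  { intros s Is. destruct (Hk s Is) as [Kp _].
    assert (E := is_derive_inner _ _ s (dT s Is) (dT s Is)).
    assert (Z := Derive_const_on I _ 1 s HI Is (ex_intro _ _ E) Htt).
    rewrite (is_derive_unique _ _ _ E) in Z.
    rewrite (HT' s Is), (IS (tangent a s)), !IC, (IS (normal a s)) in Z. nra. }
  exists (fun s => - sg * inner (vderive (normal a) s) (binormal a s)).
  intros s Is. unfold normal_sign. rewrite (Hnn s Is).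
  assert (Htm : inner (vderive (normal a) s) (tangent a s) = - sg * curvature a s).
  { assert (E := is_derive_inner _ _ s (dT s Is) (dn s Is)).
    assert (Z := Derive_const_on I _ 0 s HI Is (ex_intro _ _ E) Htn).
    rewrite (is_derive_unique _ _ _ E) in Z.
    rewrite (HT' s Is), !IC, (Hnn s Is) in Z.
    rewrite (IS (tangent a s) (vderive (normal a) s)) in Z. lra. }
  assert (Hnm : inner (vderive (normal a) s) (normal a s) = 0).
  { assert (E := is_derive_inner _ _ s (dn s Is) (dn s Is)).
    assert (Z := Derive_const_on I _ sg s HI Is (ex_intro _ _ E) Hnn).
    rewrite (is_derive_unique _ _ _ E) in Z.
    rewrite (IS (normal a s)) in Z. lra. }
  assert (Hm : vderive (normal a) s =
      plus (scal (- sg * curvature a s) (tangent a s))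
           (scal (- sg * inner (vderive (normal a) s) (binormal a s)) (binormal a s))).
  { rewrite (frame_expansion (tangent a s) (normal a s) (vderive (normal a) s) sg)
      at 1 by auto.
    rewrite Htm, Hnm. fold (binormal a s).
    apply vec_ext; unfold vx, vy, vz, scal, plus; simpl; unfold scal, plus; simpl;
        unfold mult; simpl; ring. }
  split; [apply HT'; exact Is|]. split; [exact Hm|].
  change (binormal a) with (fun u => cross (tangent a u) (normal a u)) at 1.
  rewrite vderive_cross by auto.
  set (tau := - sg * inner (vderive (normal a) s) (binormal a s)) in *.
  rewrite Hm, (HT' s Is). unfold binormal.
  assert (E := Htt s Is). assert (F := Htn s Is).
  set (t := tangent a s) in *. set (n := normal a s) in *.
  assert (K : cross t (cross t n) = plus (scal (inner t t) n) (scal (- inner t n) t)).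
  { apply vec_ext; unfold cross, inner, vx, vy, vz, scal, plus; simpl;
      unfold scal, plus; simpl; unfold mult; simpl; ring. }
  rewrite E, F in K.
  transitivity (scal tau (cross t (cross t n))).
  - generalize (curvature a s); intros k.
    apply vec_ext; unfold cross, vx, vy, vz, scal, plus; simpl;
      unfold scal, plus; simpl; unfold mult; simpl; ring.
  - rewrite K. apply vec_ext; unfold cross, vx, vy, vz, scal, plus; simpl;
      unfold scal, plus; simpl; unfold mult; simpl; ring.
Qed.

(* Main.v *)
Require Import Defs.
From Stdlib Require Import Reals Lra Psatz Classical.
From Coquelicot Require Import Coquelicot.
Open Scope R_scope.

(** Write [t = alpha'] and [T = beta'].  For curves parametrized by arc length,
    maximality of [alpha + beta] is the identity
      [<t x t', T> = <t, T x T'>]   for all [s], [t]   ([maximal_sum_surface]),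
    a pairing that is symmetric in the two curves.  A non-planar [alpha] has
    three linearly independent tangent vectors ([tangents_span]); fixing the
    corresponding three values of [s] and solving for [T x T'] shows that
      [T x T' = L T]
    for one constant linear map [L] ([linmap_of_products]).  The constants
    attached to [beta] are the invariants of [L], and by symmetry the same
    argument applies to [alpha].

    Put [q = <T',T'>] and [D = det (T, T', T'')].  Differentiating [L T = T x T']
    twice gives [L T' = T x T''] and [L T'' = T' x T'' + T x T'''], so that [L]
    is known on the frame [T, T', T''].  Its two invariants are then computed
    from scalar products: [det L = - D] ([frame_det], valid also where the frame
    degenerates), and [tr L * D = <T'',T''> - <T',T'''> - 3 q^2]
    ([frame_trace]).  Since [L] is constant, so is [D].  On the other hand
    [tau = - D / q] ([torsion_wronskian]) and [kappa^2 = |q|].  If [D] vanished,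
    the torsion would vanish identically and the curve would be planar
    ([planar_of_wronskian_zero]).  Hence [kappa^2 tau] is, up to sign, the nonzero
    constant [D], and after expressing [Sigma] through the same scalar products
    ([Sigma_eq]) the Gram identity for [D^2] turns [Sigma / tau + tau] into
    [tr L]. *)

(** * Vector algebra and linear maps *)

Ltac vec_ring :=
  try apply vec_ext;
  repeat match goal with v : vec |- _ => destruct v as [[? ?] ?] end;
  unfold det3, inner, cross, vx, vy, vz, zero, plus, scal; simpl;
  unfold zero, plus, scal; simpl; unfold mult; simpl; ring.

Lemma inner_sym (u v : vec) : inner u v = inner v u.
Proof. vec_ring. Qed.

Lemma inner_scal (k : R) (u v : vec) : inner (scal k u) v = k * inner u v.
Proof. vec_ring. Qed.

Lemma inner_cross_cross (u v w x : vec) :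
  inner (cross u v) (cross w x) = inner u x * inner v w - inner u w * inner v x.
Proof. vec_ring. Qed.

Lemma cross_cross_common (u v w : vec) :
  cross (cross u v) (cross u w) = scal (- det3 u v w) u.
Proof. vec_ring. Qed.

Lemma det3_sqr_gram (u v w : vec) :
  det3 u v w ^ 2 =
  - (inner u u * (inner v v * inner w w - inner v w ^ 2)
     - inner u v * (inner u v * inner w w - inner v w * inner u w)
     + inner u w * (inner u v * inner v w - inner v v * inner u w)).
Proof. vec_ring. Qed.

Lemma cramer (u v w x : vec) :
  scal (det3 u v w) x =
  plus (plus (scal (inner u x) (cross v w)) (scal (inner v x) (cross w u)))
       (scal (inner w x) (cross u v)).
Proof. vec_ring. Qed.

(** The linear map with columns [a], [b], [c]; its determinant is [det3 a b c]
    and its trace is [vx a + vy b + vz c]. *)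
Definition linmap (a b c w : vec) : vec :=
  plus (plus (scal (vx w) a) (scal (vy w) b)) (scal (vz w) c).

Lemma det3_linmap (a b c u v w : vec) :
  det3 (linmap a b c u) (linmap a b c v) (linmap a b c w)
  = det3 a b c * det3 u v w.
Proof. unfold linmap. vec_ring. Qed.

(** Letting [L] act as a derivation on the determinant multiplies it by the
    trace: the infinitesimal form of [det3_linmap]. *)
Lemma trace_linmap (a b c u v w : vec) :
  det3 (linmap a b c u) v w + det3 u (linmap a b c v) w
    + det3 u v (linmap a b c w)
  = (vx a + vy b + vz c) * det3 u v w.
Proof. unfold linmap. vec_ring. Qed.

(** Here [t, t1, t2, t3] stand for the unit tangent and its derivatives.
    The images [L t] and [L t1] are orthogonal to [t], with
    [L t x L t1 = - det3 t t1 t2 * t]; pairing this with [L w] compares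
    [det L] with [<t, L w>].  When the frame is a basis, take [w = t2].  When it
    is not, take [w = t x t1], which always completes [t, t1] to a basis:
    it shows that [det L] vanishes too. *)
Lemma frame_det (a b c t t1 t2 t3 : vec) :
  linmap a b c t = cross t t1 ->
  linmap a b c t1 = cross t t2 ->
  linmap a b c t2 = plus (cross t1 t2) (cross t t3) ->
  inner t t = 1 -> inner t t1 = 0 -> inner t1 t1 <> 0 ->
  det3 a b c = - det3 t t1 t2.
Proof.
  intros L0 L1 L2 Htt Htt1 Hq.
  assert (K : forall w, - det3 t t1 t2 * inner t (linmap a b c w)
                        = det3 a b c * det3 t t1 w).
  { intros w. rewrite <- det3_linmap, L0, L1, <- (cross_spec (cross t t1)),
      cross_cross_common, inner_scal. reflexivity. }
  destruct (Req_dec (det3 t t1 t2) 0) as [Z|Z].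
  - generalize (K (cross t t1)).
    rewrite <- (cross_spec t t1 (cross t t1)), inner_cross_cross, Htt, Htt1, Z. nra.
  - generalize (K t2). rewrite L2.
    replace (inner t (plus (cross t1 t2) (cross t t3))) with (det3 t t1 t2)
      by (clear; vec_ring).
    intros E. apply (Rmult_eq_reg_r (det3 t t1 t2)); [lra|exact Z].
Qed.

(** Each of the three determinants produced by [trace_linmap] is a scalar
    product of two vector products, hence reduces to scalar products. *)
Lemma frame_trace (a b c t t1 t2 t3 : vec) :
  linmap a b c t = cross t t1 ->
  linmap a b c t1 = cross t t2 ->
  linmap a b c t2 = plus (cross t1 t2) (cross t t3) ->
  inner t t = 1 -> inner t t1 = 0 -> inner t t2 = - inner t1 t1 ->
  (vx a + vy b + vz c) * det3 t t1 t2
  = inner t2 t2 - inner t1 t3 - 3 * inner t1 t1 ^ 2.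
Proof.
  intros L0 L1 L2 Htt Htt1 Htt2.
  rewrite <- trace_linmap, L0, L1, L2.
  replace (det3 (cross t t1) t1 t2) with (inner (cross t t1) (cross t1 t2))
    by (clear; vec_ring).
  replace (det3 t (cross t t2) t2) with (- inner (cross t t2) (cross t t2))
    by (clear; vec_ring).
  replace (det3 t t1 (plus (cross t1 t2) (cross t t3)))
    with (inner (cross t t1) (cross t1 t2) + inner (cross t t1) (cross t t3))
    by (clear; vec_ring).
  rewrite !inner_cross_cross, (inner_sym t1 t), (inner_sym t2 t), Htt, Htt1, Htt2. ring.
Qed.

(** Cramer's rule recovers [v] from its products with the independent vectors
    [u_i]; when these products are linear in [w], so is [v].  The columns are
    the images of the standard basis, whence the sign in the last one. *)
Lemma linmap_of_products (u1 u2 u3 a1 a2 a3 : vec) : det3 u1 u2 u3 <> 0 ->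
  exists x y z, forall w v,
    inner a1 w = inner u1 v -> inner a2 w = inner u2 v -> inner a3 w = inner u3 v ->
    linmap x y z w = v.
Proof.
  intros H. set (d := det3 u1 u2 u3) in *.
  set (col := fun p1 p2 p3 => scal (/ d)
    (plus (plus (scal p1 (cross u2 u3)) (scal p2 (cross u3 u1))) (scal p3 (cross u1 u2)))).
  exists (col (vx a1) (vx a2) (vx a3)), (col (vy a1) (vy a2) (vy a3)),
    (col (- vz a1) (- vz a2) (- vz a3)).
  intros w v E1 E2 E3.
  transitivity (col (inner a1 w) (inner a2 w) (inner a3 w)).
  - unfold linmap, col. generalize (/ d). clear. intros. vec_ring.
  - rewrite E1, E2, E3. unfold col. rewrite <- cramer. fold d.
    transitivity (scal (/ d * d) v); [clear; generalize (/ d); intros; vec_ring|].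
    rewrite Rinv_l by exact H. clear; vec_ring.
Qed.

(** * Calculus on intervals *)

Lemma Derive_zero_const (I : R -> Prop) (f : R -> R) :
  is_interval I -> (forall s, I s -> is_derive f s 0) ->
  forall x y, I x -> I y -> f x = f y.
Proof.
  intros [Hc _] Hd x y Ix Iy.
  assert (In : forall z, Rmin x y <= z <= Rmax x y -> I z).
  { intros z Hz. destruct (Rle_dec x y) as [L|L].
    - rewrite Rmin_left, Rmax_right in Hz by lra. apply (Hc x z y); auto.
    - rewrite Rmin_right, Rmax_left in Hz by lra. apply (Hc y z x); auto. }
  destruct (MVT_gen f x y (fun _ => 0)) as (c & _ & E).
  - intros z Hz. apply Hd, In; lra.
  - intros z Hz. apply derivable_continuous_pt. exists 0. apply is_derive_Reals, Hd, In; lra.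
  - lra.
Qed.

(** Identities between curves are known only on an interval, whose endpoints
    may belong to it; the derivatives still agree there because each of them
    is a one-sided limit from inside. *)
Lemma vderive_eq_on (I : R -> Prop) (f g : curve) (s : R) :
  is_interval I -> I s -> vdiff f s -> vdiff g s ->
  (forall u, I u -> f u = g u) -> vderive f s = vderive g s.
Proof.
  intros HI Is (F1 & F2 & F3) (G1 & G2 & G3) E.
  assert (K : forall h k : R -> R, ex_derive h s -> ex_derive k s ->
    (forall u, I u -> h u = k u) -> Derive h s = Derive k s).
  { intros h k Hh Hk Ehk.
    assert (Z : Derive (fun u => h u - k u) s = 0).
    { apply (Derive_const_on I _ 0 s HI Is).
      - apply (ex_derive_minus (V := R_NormedModule)); assumption.
      - intros u Iu. rewrite (Ehk u Iu). ring. }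
    rewrite Derive_minus in Z by assumption. lra. }
  apply vec_ext; (apply K; [assumption|assumption|]);
    intros u Iu; rewrite (E u Iu); reflexivity.
Qed.

Lemma is_derive_linear3 (f g h : R -> R) (x y z s : R) :
  ex_derive f s -> ex_derive g s -> ex_derive h s ->
  is_derive (fun u => f u * x + g u * y + h u * z) s
    (Derive f s * x + Derive g s * y + Derive h s * z).
Proof.
  intros F G H. auto_derive; [repeat split; assumption|].
  change (fun x : R => f x) with f.
  change (fun x : R => g x) with g.
  change (fun x : R => h x) with h. ring.
Qed.

Lemma is_derive_inner_const (v : vec) (a : curve) (s : R) : vdiff a s ->
  is_derive (fun u => inner v (a u)) s (inner v (vderive a s)).
Proof.
  intros (A & B & C).
  replace (inner v (vderive a s)) with
    (Derive (fun u => vx (a u)) s * vx v + Derive (fun u => vy (a u)) s * vy v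
     + Derive (fun u => vz (a u)) s * - vz v)
    by (unfold inner, vderive, vx, vy, vz; simpl; ring).
  apply (is_derive_ext (fun u => vx (a u) * vx v + vy (a u) * vy v + vz (a u) * - vz v)).
  - intros u. unfold inner. match goal with |- ?x = ?y => change (@eq R x y) end. ring.
  - apply is_derive_linear3; assumption.
Qed.

Lemma vdiff_cross (a b : curve) (s : R) : vdiff a s -> vdiff b s ->
  vdiff (fun u => cross (a u) (b u)) s.
Proof.
  intros (A1 & A2 & A3) (B1 & B2 & B3). repeat split.
  - eexists. apply (is_derive_cross2 _ _ _ _ s A2 B3 A3 B2).
  - eexists. apply (is_derive_cross2 _ _ _ _ s A3 B1 A1 B3).
  - apply (ex_derive_opp (V := R_NormedModule)).
    eexists. apply (is_derive_cross2 _ _ _ _ s A1 B2 A2 B1).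
Qed.

Lemma vdiff_linmap (a b c : vec) (f : curve) (s : R) : vdiff f s ->
  vdiff (fun u => linmap a b c (f u)) s /\
  vderive (fun u => linmap a b c (f u)) s = linmap a b c (vderive f s).
Proof.
  intros (F1 & F2 & F3).
  split; [repeat split; eexists; apply (is_derive_linear3 _ _ _ _ _ _ s F1 F2 F3)|].
  apply vec_ext; apply (is_derive_unique _ _ _ (is_derive_linear3 _ _ _ _ _ _ s F1 F2 F3)).
Qed.

Lemma vdiff_scal (k : R -> R) (f : curve) (s : R) : ex_derive k s -> vdiff f s ->
  vdiff (fun u => scal (k u) (f u)) s /\
  vderive (fun u => scal (k u) (f u)) s
  = plus (scal (Derive k s) (f s)) (scal (k s) (vderive f s)).
Proof.
  intros Hk (F1 & F2 & F3).
  assert (K : forall h : R -> R, ex_derive h s ->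
    is_derive (fun u => k u * h u) s (Derive k s * h s + k s * Derive h s)).
  { intros h Hh. auto_derive; [repeat split; assumption|].
    change (fun x : R => h x) with h. change (fun x : R => k x) with k. ring. }
  split.
  - repeat split; eexists; apply K; assumption.
  - apply vec_ext; apply is_derive_unique.
    + apply (K (fun u => vx (f u)) F1).
    + apply (K (fun u => vy (f u)) F2).
    + apply (K (fun u => vz (f u)) F3).
Qed.

Lemma vderive_const (v : vec) (s : R) : vderive (fun _ => v) s = zero.
Proof.
  apply vec_ext; [apply (Derive_const (vx v))|apply (Derive_const (vy v))|
    apply (Derive_const (vz v))].
Qed.

Lemma smooth_vdiff (I : R -> Prop) (a : curve) (s : R) :
  smooth_on I a -> I s ->
  locally s (fun u => vdiff a u /\ vdiff (tangent a) u /\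
    vdiff (vderive (tangent a)) u /\ vdiff (vderive (vderive (tangent a))) u).
Proof.
  intros Hsm Is. apply (filter_imp (F := locally s) _ _ (fun u H =>
    conj (H 1%nat) (conj (H 2%nat) (conj (H 3%nat) (H 4%nat)))) (Hsm s Is)).
Qed.

(** * The Frenet data in terms of the tangent vector *)

Definition tang1 (a : curve) : curve := vderive (tangent a).
Definition tang2 (a : curve) : curve := vderive (tang1 a).
Definition tang3 (a : curve) : curve := vderive (tang2 a).
Definition wronskian (a : curve) (s : R) : R := det3 (tangent a s) (tang1 a s) (tang2 a s).

Lemma tangent_unit (I : R -> Prop) (a : curve) (s : R) :
  spacelike_curve I a -> arc_length I a -> I s -> inner (tangent a s) (tangent a s) = 1.
Proof.
  intros Hsp Hal Is. specialize (Hal s Is). specialize (Hsp s Is).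
  unfold tangent, lnorm in *. destruct Hsp as [P|P].
  - rewrite Rabs_pos_eq in Hal by lra.
    rewrite <- (sqrt_sqrt (inner (vderive a s) (vderive a s))) by lra.
    rewrite Hal; ring.
  - exfalso. rewrite P in Hal.
    replace (inner zero zero) with 0 in Hal by vec_ring.
    rewrite Rabs_R0, sqrt_0 in Hal; lra.
Qed.

Lemma tangent_gram (I : R -> Prop) (a : curve) (s : R) :
  is_interval I -> smooth_on I a -> spacelike_curve I a -> arc_length I a -> I s ->
  inner (tangent a s) (tang1 a s) = 0 /\
  inner (tangent a s) (tang2 a s) = - inner (tang1 a s) (tang1 a s).
Proof.
  intros HI Hsm Hsp Hal Is.
  assert (V : forall u, I u -> vdiff (tangent a) u /\ vdiff (tang1 a) u).
  { intros u Iu. destruct (locally_singleton _ _ (smooth_vdiff I a u Hsm Iu)) as (_&A&B&_).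
    split; assumption. }
  assert (O : forall u, I u -> inner (tangent a u) (tang1 a u) = 0).
  { intros u Iu. destruct (V u Iu) as [A _].
    assert (E := is_derive_inner _ _ u A A).
    assert (Z := Derive_const_on I _ 1 u HI Iu (ex_intro _ _ E)
                   (fun w Iw => tangent_unit I a w Hsp Hal Iw)).
    rewrite (is_derive_unique _ _ _ E) in Z. fold (tang1 a) in Z.
    rewrite (inner_sym (tang1 a u)) in Z. lra. }
  split; [apply O, Is|]. destruct (V s Is) as [A B].
  assert (E := is_derive_inner _ _ s A B).
  assert (Z := Derive_const_on I _ 0 s HI Is (ex_intro _ _ E) O).
  rewrite (is_derive_unique _ _ _ E) in Z. fold (tang1 a) in Z. fold (tang2 a) in Z. lra.
Qed.

(** The sign [sg] is the causal character [epsilon] of the normal, so that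
    [kappa^2 = sg * <t', t'>] with one sign on the whole interval. *)
Lemma frenet_sign (I : R -> Prop) (a : curve) : frenet_type I a ->
  exists sg, sg * sg = 1 /\ forall s, I s -> 0 < sg * inner (tang1 a s) (tang1 a s).
Proof.
  intros [H|H]; [exists 1 | exists (-1)]; (split; [ring|]);
    intros s Is; specialize (H s Is); unfold tang1, tangent.
  - destruct H as [N [P|P]]; [lra|contradiction].
  - unfold timelike in H; lra.
Qed.

Lemma curvature_sqrt (a : curve) (s sg : R) : sg * sg = 1 ->
  0 < sg * inner (tang1 a s) (tang1 a s) ->
  curvature a s = sqrt (sg * inner (tang1 a s) (tang1 a s)).
Proof.
  intros Hsg H. unfold curvature, lnorm. fold (tang1 a). f_equal.
  rewrite <- (Rabs_pos_eq (sg * inner (tang1 a s) (tang1 a s))) by lra.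
  rewrite Rabs_mult.
  assert (E : sg = 1 \/ sg = -1) by nra.
  destruct E as [-> | ->]; [rewrite Rabs_R1|rewrite (Rabs_left (-1)) by lra]; ring.
Qed.

Lemma curvature_pos (a : curve) (s sg : R) : sg * sg = 1 ->
  0 < sg * inner (tang1 a s) (tang1 a s) ->
  0 < curvature a s /\ curvature a s ^ 2 = sg * inner (tang1 a s) (tang1 a s).
Proof.
  intros Hsg H. rewrite (curvature_sqrt a s sg Hsg H). split.
  - apply sqrt_lt_R0; exact H.
  - apply pow2_sqrt; lra.
Qed.

(** The formula is needed on a neighbourhood, and not only on the interval,
    because [Sigma] differentiates [kappa' / kappa] once more. *)
Lemma curvature_log_derive (I : R -> Prop) (a : curve) (s sg : R) :
  smooth_on I a -> I s -> sg * sg = 1 -> 0 < sg * inner (tang1 a s) (tang1 a s) ->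
  locally s (fun u =>
    is_derive (curvature a) u
      (curvature a u * (inner (tang1 a u) (tang2 a u) / inner (tang1 a u) (tang1 a u)))
    /\ 0 < curvature a u).
Proof.
  intros Hsm Is Hsg H.
  assert (Hv := smooth_vdiff I a s Hsm Is).
  assert (Hq : locally s (fun u => 0 < sg * inner (tang1 a u) (tang1 a u))).
  { apply (continuous_comp (fun u => inner (tang1 a u) (tang1 a u)) (fun x => sg * x)
      s).
    - apply (ex_derive_continuous (K := R_AbsRing) (V := R_NormedModule)).
      destruct (locally_singleton _ _ Hv) as (_ & _ & A & _).
      eexists; apply is_derive_inner; exact A.
    - apply (ex_derive_continuous (K := R_AbsRing) (V := R_NormedModule)).
      auto_derive; auto.
    - apply open_gt; exact H. }
  generalize (filter_and (F := locally s) _ _ Hv (locally_locally _ _ Hq)).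
  apply filter_imp. intros u ((_ & _ & A & _) & L).
  assert (P := locally_singleton _ _ L). simpl in P.
  split; [|apply (curvature_pos a u sg Hsg P)].
  apply (is_derive_ext_loc (fun w => sqrt (sg * inner (tang1 a w) (tang1 a w)))).
  { apply (filter_imp (F := locally u) _ _ (fun w Hw => eq_sym (curvature_sqrt a w sg Hsg Hw)) L). }
  assert (E := is_derive_inner _ _ u A A). fold (tang1 a) in E. fold (tang2 a) in E.
  rewrite (curvature_sqrt a u sg Hsg P).
  set (q := fun w => inner (tang1 a w) (tang1 a w)) in *.
  change (inner (tang1 a u) (tang1 a u)) with (q u) in *.
  rewrite (inner_sym (tang2 a u)) in E. set (m := inner (tang1 a u) (tang2 a u)) in *.
  change (is_derive (fun w => sqrt (sg * q w)) u (sqrt (sg * q u) * (m / q u))).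
  auto_derive; [split; [eexists; exact E|split; [exact P|exact Logic.I]]|].
  change (fun x : R => q x) with q. rewrite (is_derive_unique q u _ E).
  assert (S := sqrt_lt_R0 _ P). assert (S2 := sqrt_sqrt (sg * q u) (Rlt_le _ _ P)).
  assert (q u <> 0) by (intros Z; rewrite Z in P; lra).
  apply (Rmult_eq_reg_r (2 * sqrt (sg * q u) * q u)); [|nra].
  transitivity (sg * q u * m * 2); [field; lra|].
  rewrite <- S2 at 1. field; assumption.
Qed.

(** Both [kappa' / kappa = <t', t''> / <t', t'>] and
    [epsilon kappa^2 = <t', t'>] are free of signs and square roots, so [Sigma - tau^2]
    is rational in the scalar products of the derivatives of [t]. *)
Lemma Sigma_eq (I : R -> Prop) (a : curve) (tau : R -> R) (s sg : R) :
  smooth_on I a -> I s -> sg * sg = 1 -> 0 < sg * inner (tang1 a s) (tang1 a s) ->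
  Sigma a tau s =
  (inner (tang2 a s) (tang2 a s) + inner (tang1 a s) (tang3 a s))
     / inner (tang1 a s) (tang1 a s)
  - 2 * inner (tang1 a s) (tang2 a s) ^ 2 / inner (tang1 a s) (tang1 a s) ^ 2
  + inner (tang1 a s) (tang1 a s) + tau s ^ 2.
Proof.
  intros Hsm Is Hsg H.
  assert (Hq : inner (tang1 a s) (tang1 a s) <> 0) by (intros Z; rewrite Z in H; lra).
  destruct (curvature_pos a s sg Hsg H) as [Kp _].
  assert (E : normal_sign a s * curvature a s ^ 2 = inner (tang1 a s) (tang1 a s)).
  { unfold normal_sign, normal. fold (tang1 a).
    rewrite inner_scal, inner_sym, inner_scal. field; lra. }
  unfold Sigma. rewrite E.
  rewrite (Derive_ext_loc _ (fun u => inner (tang1 a u) (tang2 a u)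
                                       / inner (tang1 a u) (tang1 a u))).
  2:{ generalize (curvature_log_derive I a s sg Hsm Is Hsg H). apply filter_imp.
      intros u [D P]. rewrite (is_derive_unique _ _ _ D).
      match goal with |- ?x = ?y => change (@eq R x y) end.
      unfold Rdiv. rewrite (Rmult_comm (curvature a u)), Rmult_assoc, Rinv_r by lra. ring. }
  destruct (locally_singleton _ _ (smooth_vdiff I a s Hsm Is)) as (_ & _ & A & B).
  assert (Dm := is_derive_inner _ _ s A B). assert (Dq := is_derive_inner _ _ s A A).
  fold (tang1 a) in Dm, Dq. fold (tang2 a) in Dm, Dq. fold (tang3 a) in Dm.
  rewrite Derive_div; [|eexists; exact Dm|eexists; exact Dq|exact Hq].
  rewrite (is_derive_unique (fun u : R => inner (tang1 a u) (tang2 a u)) s _ Dm),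
    (is_derive_unique (fun u : R => inner (tang1 a u) (tang1 a u)) s _ Dq).
  rewrite (inner_sym (tang2 a s) (tang1 a s)). field. exact Hq.
Qed.

(** The third Frenet equation, paired with [t']: in
    [b' = t' x n + t x n'] only the [t''] part of [n'] contributes. *)
Lemma torsion_wronskian (I : R -> Prop) (a : curve) (tau : R -> R) (s sg : R) :
  smooth_on I a -> I s -> sg * sg = 1 -> 0 < sg * inner (tang1 a s) (tang1 a s) ->
  is_torsion I a tau ->
  vdiff (binormal a) s /\
  tau s * inner (tang1 a s) (tang1 a s) = - wronskian a s.
Proof.
  intros Hsm Is Hsg H Ht.
  destruct (locally_singleton _ _ (smooth_vdiff I a s Hsm Is)) as (_ & T & A & _).
  destruct (locally_singleton _ _ (curvature_log_derive I a s sg Hsm Is Hsg H)) as [Dk Kp].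
  assert (Ki : ex_derive (fun u => / curvature a u) s).
  { apply ex_derive_inv; [eexists; exact Dk|apply Rgt_not_eq, Kp]. }
  destruct (vdiff_scal _ _ s Ki A) as [Vn En].
  change (vdiff (normal a) s) in Vn.
  split; [apply (vdiff_cross _ _ s T Vn)|].
  destruct (Ht s Is) as (_ & _ & Hb).
  assert (E := vderive_cross _ _ s T Vn).
  change (vderive (binormal a) s = plus (cross (tang1 a s) (normal a s))
    (cross (tangent a s) (vderive (fun u => scal (/ curvature a u) (vderive (tangent a) u)) s))) in E.
  rewrite En, Hb in E. apply (f_equal (fun v => inner v (tang1 a s))) in E.
  revert E. unfold normal, wronskian. fold (tang1 a). fold (tang2 a).
  set (k := / curvature a s). set (k' := Derive _ s). intros E.
  assert (kp : 0 < k) by (apply Rinv_0_lt_compat, Kp).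
  rewrite !inner_scal in E.
  replace (inner (plus (cross (tang1 a s) (scal k (tang1 a s)))
            (cross (tangent a s)
               (plus (scal k' (tang1 a s)) (scal k (tang2 a s))))) (tang1 a s))
    with (- k * det3 (tangent a s) (tang1 a s) (tang2 a s)) in E
    by (clear; generalize (tangent a s) (tang1 a s) (tang2 a s); intros; vec_ring).
  nra.
Qed.

(** * Planar curves *)

Lemma planar_of_orthogonal (I : R -> Prop) (a : curve) (v : vec) :
  is_interval I -> smooth_on I a -> v <> zero ->
  (forall s, I s -> inner v (tangent a s) = 0) -> planar I a.
Proof.
  intros HI Hsm Hv H. destruct HI as [Hc [x0 [y0 [Ix0 R0]]]].
  exists (fun p => inner v p = inner v (a x0)). split.
  (* the minus sign converts the Lorentzian product into plane coefficients *)
  - exists (vx v), (vy v), (- vz v), (inner v (a x0)). split.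
    + intros E. apply Hv. injection E as E1 E2 E3.
      apply vec_ext; simpl; try assumption. change (vz v = 0). lra.
    + intros p. unfold inner. split; intros E; lra.
  - intros s Is. apply (Derive_zero_const I (fun u => inner v (a u))); [|  | exact Is | exact Ix0].
    + split; [exact Hc|exists x0, y0; split; assumption].
    + intros u Iu. rewrite <- (H u Iu). apply is_derive_inner_const.
      apply (locally_singleton _ _ (smooth_vdiff I a u Hsm Iu)).
Qed.

Lemma cross_nonzero (u v : vec) :
  inner u u = 1 -> inner u v = 0 -> inner v v <> 0 -> cross u v <> zero.
Proof.
  intros E1 E2 H Z. apply H.
  generalize (inner_cross_cross u v u v). rewrite Z, E1, E2, (inner_sym v u), E2.
  replace (inner zero zero) with 0 by (clear; vec_ring). lra.
Qed.

(** The torsion vanishes, so the binormal is a constant vector orthogonal to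
    all tangents. *)
Lemma planar_of_wronskian_zero (I : R -> Prop) (a : curve) (tau : R -> R) :
  is_interval I -> smooth_on I a -> spacelike_curve I a -> arc_length I a ->
  frenet_type I a -> is_torsion I a tau ->
  (forall s, I s -> wronskian a s = 0) -> planar I a.
Proof.
  intros HI Hsm Hsp Hal Hfr Ht HD.
  destruct (frenet_sign I a Hfr) as (sg & Hsg & Hq).
  assert (Z : forall s, I s -> vdiff (binormal a) s /\ vderive (binormal a) s = zero).
  { intros s Is. destruct (torsion_wronskian I a tau s sg Hsm Is Hsg (Hq s Is) Ht) as [V E].
    split; [exact V|]. destruct (Ht s Is) as (_ & _ & ->).
    rewrite (HD s Is), Ropp_0 in E. specialize (Hq s Is).
    apply Rmult_integral in E. destruct E as [-> | E]; [|rewrite E in Hq; lra].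
    generalize (normal a s); intros; vec_ring. }
  assert (HI' := HI). destruct HI' as [_ [x0 [_ [Ix0 _]]]].
  assert (C : forall s, I s -> binormal a s = binormal a x0).
  { intros s Is.
    apply vec_ext; refine (Derive_zero_const I (fun u => _ (binormal a u)) HI _ s x0 Is Ix0);
      intros u Iu; destruct (Z u Iu) as [(V1 & V2 & V3) E].
    - change 0 with (vx zero). rewrite <- E. apply Derive_correct, V1.
    - change 0 with (vy zero). rewrite <- E. apply Derive_correct, V2.
    - change 0 with (vz zero). rewrite <- E. apply Derive_correct, V3. }
  apply (planar_of_orthogonal I a (binormal a x0) HI Hsm).
  - destruct (tangent_gram I a x0 HI Hsm Hsp Hal Ix0) as [O _].
    destruct (curvature_pos a x0 sg Hsg (Hq x0 Ix0)) as [Kp _].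
    assert (kp := Rinv_0_lt_compat _ Kp).
    assert (q0 := Hq x0 Ix0).
    apply cross_nonzero; unfold normal; fold (tang1 a).
    + apply (tangent_unit I a x0 Hsp Hal Ix0).
    + rewrite inner_sym, inner_scal, inner_sym, O; ring.
    + rewrite inner_scal, inner_sym, inner_scal. intros E.
      apply Rmult_integral in E. destruct E as [E|E]; [lra|].
      apply Rmult_integral in E. destruct E as [E|E]; [lra|].
      rewrite E in q0; lra.
  - intros s Is. rewrite <- (C s Is). unfold binormal.
    generalize (tangent a s) (normal a s); intros; vec_ring.
Qed.

(** Fix [t(s0)].  Some [t(s1)] is not proportional to it: otherwise
    differentiating [t(s0) x t(s) = 0] at [s0] makes [t(s0)] and [t'(s0)]
    dependent, against the Frenet condition.  If all tangents were in the plane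
    of [t(s0)] and [t(s1)], the curve would be planar. *)
Lemma tangents_span (I : R -> Prop) (a : curve) :
  is_interval I -> smooth_on I a -> spacelike_curve I a -> arc_length I a ->
  frenet_type I a -> ~ planar I a ->
  exists s0 s1 s2, I s0 /\ I s1 /\ I s2 /\
    det3 (tangent a s0) (tangent a s1) (tangent a s2) <> 0.
Proof.
  intros HI Hsm Hsp Hal Hfr Hnp.
  destruct (frenet_sign I a Hfr) as (sg & Hsg & Hq).
  assert (HI' := HI). destruct HI' as [_ [x0 [_ [Ix0 _]]]].
  assert (V : vdiff (tangent a) x0)
    by apply (locally_singleton _ _ (smooth_vdiff I a x0 Hsm Ix0)).
  destruct (classic (forall s, I s -> cross (tangent a x0) (tangent a s) = zero)) as [Z|Z].
  - exfalso.
    destruct (tangent_gram I a x0 HI Hsm Hsp Hal Ix0) as [O _].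
    apply (cross_nonzero (tangent a x0) (tang1 a x0)); [| exact O | |].
    + apply (tangent_unit I a x0 Hsp Hal Ix0).
    + intros E. specialize (Hq x0 Ix0). rewrite E in Hq. lra.
    + set (c := tangent a x0) in *.
      assert (Vc : vdiff (fun _ => c) x0).
      { repeat split; apply ex_derive_const. }
      assert (Vz : vdiff (fun _ => zero) x0).
      { repeat split; apply ex_derive_const. }
      assert (E := eq_trans (eq_sym (vderive_cross _ _ x0 Vc V))
        (vderive_eq_on I _ _ x0 HI Ix0 (vdiff_cross _ _ x0 Vc V) Vz Z)).
      change (vderive (tangent a) x0) with (tang1 a x0) in E.
      rewrite !vderive_const in E. cbv beta in E. rewrite <- E.
      generalize c (tangent a x0) (tang1 a x0). intros; vec_ring.
  - apply not_all_ex_not in Z. destruct Z as [s1 Z]. apply imply_to_and in Z.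
    destruct Z as [I1 Z].
    destruct (classic (forall s, I s ->
      inner (cross (tangent a x0) (tangent a s1)) (tangent a s) = 0)) as [W|W].
    + exfalso. apply Hnp, (planar_of_orthogonal I a _ HI Hsm Z W).
    + apply not_all_ex_not in W. destruct W as [s2 W]. apply imply_to_and in W.
      destruct W as [I2 W]. rewrite cross_spec in W.
      exists x0, s1, s2. repeat split; assumption.
Qed.

(** * Invariants of the constant linear map *)

(** The constants are [c1 = epsilon * det L] and [c2 = tr L]. *)
Lemma invariants_of_linear_relation (I : R -> Prop) (a : curve) (tau : R -> R)
  (x y z : vec) :
  is_interval I -> smooth_on I a -> spacelike_curve I a -> arc_length I a ->
  frenet_type I a -> is_torsion I a tau -> ~ planar I a ->
  (forall s, I s -> linmap x y z (tangent a s) = cross (tangent a s) (tang1 a s)) ->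
  exists c1 c2, c1 <> 0 /\
    (forall s, I s -> curvature a s ^ 2 * tau s = c1) /\
    (forall s, I s -> Sigma a tau s / tau s + tau s = c2).
Proof.
  intros HI Hsm Hsp Hal Hfr Ht Hnp L0.
  destruct (frenet_sign I a Hfr) as (sg & Hsg & Hq).
  assert (V : forall s, I s ->
    vdiff (tangent a) s /\ vdiff (tang1 a) s /\ vdiff (tang2 a) s).
  { intros s Is. apply (locally_singleton _ _ (smooth_vdiff I a s Hsm Is)). }
  assert (L1 : forall s, I s ->
    linmap x y z (tang1 a s) = cross (tangent a s) (tang2 a s)).
  { intros s Is. destruct (V s Is) as (V0 & V1 & _).
    destruct (vdiff_linmap x y z _ s V0) as [VL EL].
    change (linmap x y z (tang1 a s)) with (linmap x y z (vderive (tangent a) s)).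
    rewrite <- EL, (vderive_eq_on I _ _ s HI Is VL (vdiff_cross _ _ s V0 V1) L0).
    rewrite (vderive_cross _ _ s V0 V1).
    change (vderive (tangent a) s) with (tang1 a s).
    change (vderive (tang1 a) s) with (tang2 a s).
    generalize (tangent a s) (tang1 a s) (tang2 a s). clear. intros. vec_ring. }
  assert (L2 : forall s, I s -> linmap x y z (tang2 a s) =
    plus (cross (tang1 a s) (tang2 a s)) (cross (tangent a s) (tang3 a s))).
  { intros s Is. destruct (V s Is) as (V0 & V1 & V2).
    destruct (vdiff_linmap x y z _ s V1) as [VL EL].
    change (linmap x y z (tang2 a s)) with (linmap x y z (vderive (tang1 a) s)).
    rewrite <- EL, (vderive_eq_on I _ _ s HI Is VL (vdiff_cross _ _ s V0 V2) L1).
    exact (vderive_cross _ _ s V0 V2). }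
  assert (q0 : forall s, I s -> inner (tang1 a s) (tang1 a s) <> 0).
  { intros s Is E. specialize (Hq s Is). rewrite E in Hq. lra. }
  assert (HD : forall s, I s -> wronskian a s = - det3 x y z).
  { intros s Is. unfold wronskian.
    rewrite (frame_det x y z _ _ _ _ (L0 s Is) (L1 s Is) (L2 s Is)
      (tangent_unit I a s Hsp Hal Is)
      (proj1 (tangent_gram I a s HI Hsm Hsp Hal Is)) (q0 s Is)). ring. }
  assert (D0 : det3 x y z <> 0).
  { intros Z. apply Hnp, (planar_of_wronskian_zero I a tau); try assumption.
    intros s Is. rewrite (HD s Is), Z. ring. }
  exists (sg * det3 x y z), (vx x + vy y + vz z). repeat split.
  - intros Z. apply Rmult_integral in Z. destruct Z as [Z|Z]; [rewrite Z in Hsg; lra|tauto].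
  - intros s Is. destruct (curvature_pos a s sg Hsg (Hq s Is)) as [_ ->].
    destruct (torsion_wronskian I a tau s sg Hsm Is Hsg (Hq s Is) Ht) as [_ E].
    rewrite (HD s Is) in E. rewrite <- (Ropp_involutive (det3 x y z)), <- E. ring.
  - intros s Is.
    destruct (torsion_wronskian I a tau s sg Hsm Is Hsg (Hq s Is) Ht) as [_ E].
    destruct (tangent_gram I a s HI Hsm Hsp Hal Is) as [O1 O2].
    assert (U := tangent_unit I a s Hsp Hal Is).
    assert (Tr := frame_trace x y z _ _ _ _ (L0 s Is) (L1 s Is) (L2 s Is) U O1 O2).
    assert (G := det3_sqr_gram (tangent a s) (tang1 a s) (tang2 a s)).
    rewrite U, O1, O2 in G.
    rewrite (Sigma_eq I a tau s sg Hsm Is Hsg (Hq s Is)).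
    assert (Q := q0 s Is).
    assert (W : wronskian a s <> 0) by (rewrite (HD s Is); lra).
    change (det3 (tangent a s) (tang1 a s) (tang2 a s)) with (wronskian a s) in *.
    set (q := inner (tang1 a s) (tang1 a s)) in *. set (D := wronskian a s) in *.
    set (m := inner (tang1 a s) (tang2 a s)) in *.
    set (r := inner (tang2 a s) (tang2 a s)) in *.
    set (p := inner (tang1 a s) (tang3 a s)) in *.
    replace (tau s) with (- D / q) by (rewrite <- E; field; exact Q).
    apply (Rmult_eq_reg_r D); [|exact W]. rewrite Tr.
    (* the middle term still contains [D ^ 2], which the Gram identity removes *)
    transitivity (- (r + p) + 2 * m ^ 2 / q - q ^ 2 - 2 * D ^ 2 / q).
    + field. split; assumption.
    + rewrite G. field. exact Q.
Qed.

(** * Maximal translation surfaces *)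

(** Holding for every [f] and [s], this makes the formulas for the partial
    derivatives of the surface identities of functions on the whole plane, which
    can be differentiated again. *)
Lemma Derive_plus_const (f : R -> R) (c s : R) : Derive (fun u => f u + c) s = Derive f s.
Proof.
  unfold Derive. f_equal. apply Lim_ext. intros h. unfold Rdiv. ring.
Qed.

Lemma d1_sum_surface (a b : curve) (s t : R) :
  Defs.d1 (sum_surface a b) s t = tangent a s.
Proof.
  unfold Defs.d1, sum_surface, tangent, vderive.
  rewrite <- (Derive_plus_const (fun u => vx (a u)) (vx (b t))),
    <- (Derive_plus_const (fun u => vy (a u)) (vy (b t))),
    <- (Derive_plus_const (fun u => vz (a u)) (vz (b t))). reflexivity.
Qed.

Lemma vderive_ext (f g : curve) (s : R) : (forall u, f u = g u) -> vderive f s = vderive g s.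
Proof.
  intros H. apply vec_ext; apply Derive_ext; intros u; rewrite H; reflexivity.
Qed.

Lemma d2_sum_surface (a b : curve) (s t : R) :
  Defs.d2 (sum_surface a b) s t = tangent b t.
Proof.
  rewrite <- (d1_sum_surface b a t s). apply vderive_ext. intros u.
  unfold sum_surface. generalize (a s) (b u). intros; vec_ring.
Qed.

(** With [E = G = 1] and no mixed derivative, [H = 0] says that
    [N = t x T] is orthogonal to [t' + T'].  The Riemannian condition, tested on
    [- F t + T], gives [1 - F^2 > 0], so the factors that are divided out do not
    vanish. *)
Lemma maximal_sum_surface (I J : R -> Prop) (a b : curve) (s t : R) :
  maximal_on I J (sum_surface a b) ->
  spacelike_curve I a -> spacelike_curve J b -> arc_length I a -> arc_length J b ->
  I s -> J t ->
  inner (cross (tangent a s) (tang1 a s)) (tangent b t)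
  = inner (tangent a s) (cross (tangent b t) (tang1 b t)).
Proof.
  intros [Hr Hm] Hsa Hsb Hla Hlb Is Jt.
  specialize (Hm s t Is Jt). specialize (Hr s t Is Jt).
  assert (Ua := tangent_unit I a s Hsa Hla Is).
  assert (Ub := tangent_unit J b t Hsb Hlb Jt).
  revert Hm Hr. unfold mean_curvature, unit_normal.
  assert (E11 : Defs.d1 (Defs.d1 (sum_surface a b)) s t = tang1 a s).
  { apply vderive_ext; intros u; apply d1_sum_surface. }
  assert (E22 : Defs.d2 (Defs.d2 (sum_surface a b)) s t = tang1 b t).
  { apply vderive_ext; intros u; apply d2_sum_surface. }
  assert (E12 : Defs.d2 (Defs.d1 (sum_surface a b)) s t = zero).
  { transitivity (vderive (fun _ => tangent a s) t).
    - apply vderive_ext; intros u; apply d1_sum_surface.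
    - apply vderive_const. }
  rewrite E11, E22, E12, d1_sum_surface, d2_sum_surface, Ua, Ub.
  set (F := inner (tangent a s) (tangent b t)).
  set (N := cross (tangent a s) (tangent b t)).
  intros Hm Hr.
  assert (HF : 0 < 1 - F ^ 2).
  { (* the component of [T] orthogonal to [t] has square [1 - F ^ 2] *)
    specialize (Hr (- F) 1). simpl in Hr.
    assert (P : (- F, 1) <> (0, 0)) by (intros E; injection E; lra).
    apply Hr in P.
    replace (inner _ _) with
      (F * F * inner (tangent a s) (tangent a s) - 2 * F * F
       + inner (tangent b t) (tangent b t)) in P
      by (unfold F; generalize (tangent a s) (tangent b t); clear; intros; vec_ring).
    rewrite Ua, Ub in P. lra. }
  assert (HN : inner N N = - (1 - F ^ 2)).
  { unfold N. rewrite inner_cross_cross, (inner_sym (tangent b t) (tangent a s)), Ua, Ub.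
    fold F. ring. }
  assert (Kp : 0 < lnorm N).
  { apply sqrt_lt_R0, Rabs_pos_lt. lra. }
  set (k := / lnorm N) in *.
  assert (kp : 0 < k) by (apply Rinv_0_lt_compat, Kp).
  rewrite !inner_scal, (inner_sym N (scal k N)), inner_scal, HN in Hm.
  assert (S : inner N (tang1 a s) + inner N (tang1 b t) = 0).
  { set (e := inner N (tang1 a s)) in *. set (g := inner N (tang1 b t)) in *.
    replace (inner N zero) with 0 in Hm by (clear; generalize N; intros; vec_ring).
    replace (_ / _) with (- (k ^ 3 / 2) * (e + g)) in Hm by (field; lra).
    assert (0 < k ^ 3 / 2) by (assert (0 < k ^ 3) by (apply pow_lt, kp); lra).
    apply Rmult_integral in Hm. destruct Hm; lra. }
  revert S. unfold N. rewrite !cross_spec. clear.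
  generalize (tangent a s) (tangent b t) (tang1 a s) (tang1 b t). intros u v u' v' S.
  apply Rminus_diag_uniq. rewrite <- Ropp_0, <- S. vec_ring.
Qed.

(** Only the pairing identity links the two curves; it is symmetric in them, so
    one lemma serves for both. *)
Lemma invariants_of_pairing (I J : R -> Prop) (a b : curve) (tau : R -> R) :
  is_interval I -> smooth_on I a -> spacelike_curve I a -> arc_length I a ->
  frenet_type I a -> ~ planar I a ->
  is_interval J -> smooth_on J b -> spacelike_curve J b -> arc_length J b ->
  frenet_type J b -> ~ planar J b -> is_torsion J b tau ->
  (forall s t, I s -> J t ->
    inner (cross (tangent a s) (tang1 a s)) (tangent b t)
    = inner (tangent a s) (cross (tangent b t) (tang1 b t))) ->
  exists c1 c2, c1 <> 0 /\
    (forall t, J t -> curvature b t ^ 2 * tau t = c1) /\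
    (forall t, J t -> Sigma b tau t / tau t + tau t = c2).
Proof.
  intros HI Hsa Hspa Hala Hfa Hna HJ Hsb Hspb Halb Hfb Hnb Ht Hpair.
  destruct (tangents_span I a HI Hsa Hspa Hala Hfa Hna) as (s0 & s1 & s2 & I0 & I1 & I2 & H).
  destruct (linmap_of_products _ _ _ (cross (tangent a s0) (tang1 a s0))
    (cross (tangent a s1) (tang1 a s1)) (cross (tangent a s2) (tang1 a s2)) H)
    as (x & y & z & L).
  apply (invariants_of_linear_relation J b tau x y z); try assumption.
  intros t Jt. apply L; apply Hpair; assumption.
Qed.

Theorem theorem4p1 (I J : R -> Prop) (alpha beta : curve) (tau_a tau_b : R -> R)
  (hX : translation_surface I J alpha beta)
  (hmax : maximal_on I J (sum_surface alpha beta))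
  (hspa : spacelike_curve I alpha) (hspb : spacelike_curve J beta)
  (hala : arc_length I alpha) (halb : arc_length J beta)
  (hfa : frenet_type I alpha) (hfb : frenet_type J beta)
  (hta : is_torsion I alpha tau_a) (htb : is_torsion J beta tau_b)
  (hnpa : ~ planar I alpha) (hnpb : ~ planar J beta) :
  exists c1 c1' c2 c2' : R,
    c1 <> 0 /\ c1' <> 0 /\
    (forall s, I s -> curvature alpha s ^ 2 * tau_a s = c1) /\
    (forall t, J t -> curvature beta t ^ 2 * tau_b t = c1') /\
    (forall s, I s -> Sigma alpha tau_a s / tau_a s + tau_a s = c2) /\
    (forall t, J t -> Sigma beta tau_b t / tau_b t + tau_b t = c2').
Proof.
  destruct hX as (HI & HJ & hsa & hsb & _).
  assert (P := fun s t => maximal_sum_surface I J alpha beta s t hmax hspa hspb hala halb).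
  destruct (invariants_of_pairing I J alpha beta tau_b) as (c1' & c2' & K1 & K2 & K3);
    try assumption.
  destruct (invariants_of_pairing J I beta alpha tau_a) as (c1 & c2 & L1 & L2 & L3);
    try assumption.
  { intros t s Jt Is. rewrite inner_sym, <- (P s t Is Jt). apply inner_sym. }
  exists c1, c1', c2, c2'. tauto.
Qed.
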